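(* Let $\{x^k\}$ be the sequence generated by the ADCA-Like (Accelerated DCA-Like) algorithm (described in the context, which also defines the points $v^k$ and the parameters $\mu_k$). The following statements hold. (i) The sequence $\{\varphi(x^k,g(x^k))\}$ is decreasing (nonincreasing). More precisely, for all $k\ge0$, $$\varphi(x^k,g(x^k))-\varphi(x^{k+1},g(x^{k+1}))\ \ge\ \frac{\mu_k}{2}\|x^{k+1}-v^k\|^2 .$$ (ii) If $\alpha=\inf\varphi(x,z)>-\infty$, then $\sum_{k=0}^{+\infty}\|x^{k+1}-v^k\|^2<+\infty$, and therefore $\lim_{k\to+\infty}\|x^{k+1}-v^k\|=0$. (iii) If $\alpha=\inf\varphi(x,z)>-\infty$, then any limit point of $\{(x^k,g(x^k))\}$ is a critical point of the problem $\min_{(x,z)}\varphi(x,z)$.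
   Context: Setting. $n=\sum_{i=1}^m n_i$, and $x\in\mathbb{R}^n$ is written in blocks $x=(x_1,\dots,x_m)$ with $x_i\in\mathbb{R}^{n_i}$. $X\subset\mathbb{R}^n$ is a closed convex set. $f:\mathbb{R}^n\to\mathbb{R}$ is continuously differentiable (possibly nonconvex) with $L$-Lipschitz continuous gradient. For $i=1,\dots,m$, $g_i:\mathbb{R}^{n_i}\to\mathbb{R}$ is a continuous convex (possibly nonsmooth) function. For $i=1,\dots,m$, $h_i:D_i\to\mathbb{R}$ is concave and increasing (in the sense of nondecreasing), where $D_i\subset\mathbb{R}$ is an open interval, unbounded above, containing $g_i(x_i)$ for all $x\in X$; and the convex subdifferential satisfies $\partial(-h_i)(t)\subset(-\infty,0]$ whenever $t\ge g_i(x_i)$ for some $x\in X$. Notation. $g(x)=(g_1(x_1),\dots,g_m(x_m))\in\mathbb{R}^m$; $\Omega=\{(x,z)\in\mathbb{R}^n\times\mathbb{R}^m: x\in X,\ g_i(x_i)\le z_i,\ i=1,\dots,m\}$; $\chi_\Omega=0$ on $\Omega$ and $+\infty$ elsewhere; $$\varphi(x,z)=\chi_\Omega(x,z)+f(x)+\sum_{i=1}^m h_i(z_i)$$ (equal to $+\infty$ outside $\Omega$). For $\mu>0$: $G_\mu(x,z)=\frac{\mu}{2}\|x\|^2+\chi_\Omega(x,z)$ and $H_\mu(x,z)=\frac{\mu}{2}\|x\|^2-f(x)-\sum_{i=1}^m h_i(z_i)$, so $\varphi=G_\mu-H_\mu$; for $\mu\ge L$ both are convex. Norms are Euclidean. Critical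 point. $(x^*,z^* )$ is a critical point of $\min\varphi$ if $\partial H_\mu(x^*,z^* )\cap\partial G_\mu(x^*,z^* )\neq\emptyset$ (convex subdifferentials) for $\mu\ge L$, $\mu>0$; here $\partial H_\mu(x,z)=\{\mu x-\nabla f(x)\}\times\prod_{i=1}^m\partial(-h_i)(z_i)$, and the condition does not depend on the choice of $\mu$. ADCA-Like algorithm. Inputs: $x^0\in X$, $w^0=x^0$, $\eta>1$, $0<\delta<1$, $\underline{\mu}>0$, and an initial real number $t_0$. For $k=0,1,2,\dots$ (run without stopping, producing an infinite sequence): 1. If $\varphi(w^k,g(w^k))\le\varphi(x^k,g(x^k))$ set $v^k=w^k$, else set $v^k=x^k$. 2. Choose $\xi_i^k\in\partial(-h_i)(g_i(v_i^k))$, $i=1,\dots,m$, put $\xi^k=(\xi^k_1,\dots,\xi^k_m)$, and compute $\nabla f(v^k)$. 3. Set $\mu_k=\underline{\mu}$ if $k=0$, and $\mu_k=\max\{\underline{\mu},\delta\mu_{k-1}\}$ if $k>0$. 4. Let $x^{k+1}$ be the minimizer over $x\in X$ of $\frac{\mu_k}{2}\|x-v^k\|^2+\langle\nabla f(v^k),x\rangle+\sum_{i=1}^m(-\xi_i^k)g_i(x_i)$. 5. While $H_{\mu_k}(x^{k+1},g(x^{k+1}))<H_{\mu_k}(v^k,g(v^k))+\langle\mu_kv^k-\nabla f(v^k),x^{k+1}-v^k\rangle+\langle\xi^k,g(x^{k+1})-g(v^k)\rangle$, replace $\mu_k$ by $\eta\mu_k$ and recompute $x^{k+1}$ by step 4.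 6. Compute $t_{k+1}=\frac{1+\sqrt{1+4t_k^2}}{2}$. 7. Compute $w^{k+1}=x^{k+1}+\frac{t_k-1}{t_{k+1}}(x^{k+1}-x^k)$. In the claim, $\mu_k$ denotes the final value of $\mu_k$ at iteration $k$, after step 5. *)

(* Defs.v *)
From HB Require Import structures.
From mathcomp Require Import all_boot all_order all_algebra.
From mathcomp Require Import all_classical all_reals all_analysis.

Set Implicit Arguments.
Unset Strict Implicit.
Unset Printing Implicit Defensive.

Import Order.TTheory GRing.Theory Num.Theory numFieldNormedType.Exports.

Local Open Scope classical_set_scope.
Local Open Scope ring_scope.

Section Euclidean.
Context {R : realType}.

Definition dot {k : nat} (u v : 'rV[R]_k) : R := \sum_(j < k) u 0 j * v 0 j.

(* The library norm on matrices is the sup norm; it induces the same topology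
   as this one, but the estimates below are about the Euclidean norm. *)
Definition enorm {k : nat} (u : 'rV[R]_k) : R := Num.sqrt (dot u u).

Definition dot2 {k l : nat} (p q : 'rV[R]_k * 'rV[R]_l) : R :=
  dot p.1 q.1 + dot p.2 q.2.

Definition grad {k : nat} (f : 'rV[R]_k -> R) (x : 'rV[R]_k) : 'rV[R]_k :=
  \row_j 'D_(delta_mx 0 j) f x.

(* Convex subdifferential, with respect to the inner product [ip], of an
   extended-valued function; it is empty off the effective domain. *)
Definition subdiff {V : zmodType} (ip : V -> V -> R) (F : V -> \bar R) (p : V) :
    set V :=
  [set s | F p \is a fin_num /\
           forall q, (F p + (ip s (q - p))%:E <= F q)%E].

Definition is_minimizer_on {V : Type} (A : set V) (Q : V -> R) (y : V) : Prop :=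
  A y /\ forall u, A u -> Q y <= Q u.

End Euclidean.

(* The block x_i of x : 'rV_(\sum_i n_ i) is [submxrow x i : 'rV_(n_ i)].
   [h_ P i] is a total function standing for a function on [D_ P i]; its values
   outside [D_ P i] play no role. *)
Record problem (R : realType) (m : nat) (n_ : 'I_m -> nat) := Problem {
  X_ : set 'rV[R]_(\sum_i n_ i);
  f_ : 'rV[R]_(\sum_i n_ i) -> R;
  g_ : forall i : 'I_m, 'rV[R]_(n_ i) -> R;
  D_ : 'I_m -> set R;
  h_ : 'I_m -> R -> R }.

Section Problem.
Context {R : realType} {m : nat} {n_ : 'I_m -> nat} (P : problem R n_).

Local Notation V := 'rV[R]_(\sum_i n_ i).
Local Notation Z := 'rV[R]_m.
Local Notation X := (X_ P).
Local Notation f := (f_ P).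
Local Notation g := (g_ P).
Local Notation D := (D_ P).
Local Notation h := (h_ P).

Definition gvec (x : V) : Z := \row_i g (submxrow x i).

(* -h_i, extended by +oo outside D_i *)
Definition neg_h (i : 'I_m) (t : R) : \bar R :=
  if t \in D i then (- h i t)%:E else +oo%E.

Definition Omega : set (V * Z) :=
  [set p : V * Z | X p.1 /\ forall i, g (submxrow p.1 i) <= p.2 0 i].

Definition chi_Omega (p : V * Z) : \bar R := if p \in Omega then 0%E else +oo%E.

Definition phi (p : V * Z) : \bar R :=
  (chi_Omega p + (f p.1 + \sum_(i < m) h i (p.2 0%R i))%:E)%E.

Definition G (mu : R) (p : V * Z) : \bar R :=
  ((mu / 2 * enorm p.1 ^+ 2)%:E + chi_Omega p)%E.

Definition H (mu : R) (p : V * Z) : \bar R :=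
  ((mu / 2 * enorm p.1 ^+ 2 - f p.1)%:E + \sum_(i < m) neg_h i (p.2 0%R i))%E.

Record standing_assumptions (L : R) : Prop := {
  X_closed : closed X;
  X_convex : convex_set X;
  f_differentiable : forall x, differentiable f x;
  grad_continuous : continuous (grad f);
  L_ge0 : 0 <= L;
  grad_lipschitz : forall x y,
    enorm (grad f x - grad f y) <= L * enorm (x - y);
  g_continuous : forall i, continuous (g (i := i));
  g_convex : forall i, @convex_function R 'rV[R]_(n_ i) setT (g (i := i));
  D_open : forall i, open (D i);
  D_interval : forall i, is_interval (D i);
  D_unbounded : forall i, ~ has_ubound (D i);
  D_contains : forall x i, X x -> D i (g (submxrow x i));
  h_concave : forall i, @convex_function R R^o (D i) (fun t => - h i t);
  h_nondecreasing : forall i, {in D i &, {homo h i : s t / s <= t}};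
  subdiff_neg_h_le0 : forall i t,
    (exists2 x, X x & g (submxrow x i) <= t) ->
    subdiff *%R (neg_h i) t `<=` [set s | s <= 0] }.

(* L is a Lipschitz constant of grad f; H mu and G mu are then convex. *)
Definition is_critical (L : R) (p : V * Z) : Prop :=
  forall mu : R, 0 < mu -> L <= mu ->
    subdiff dot2 (H mu) p `&` subdiff dot2 (G mu) p !=set0.

Definition subproblem (mu : R) (v : V) (xi : Z) (y : V) : R :=
  mu / 2 * enorm (y - v) ^+ 2 + dot (grad f v) y
  + \sum_(i < m) (- xi 0 i) * g (submxrow y i).

Definition backtrack_test (mu : R) (v : V) (xi : Z) (y : V) : bool :=
  (H mu (y, gvec y) <
   H mu (v, gvec v)
   + (dot (mu *: v - grad f v) (y - v) + dot xi (gvec y - gvec v))%:E)%E.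

(* [backtrack eta v xi mu mu' y]: started at mu, the backtracking loop stops
   with the value mu' and the point y. *)
Inductive backtrack (eta : R) (v : V) (xi : Z) : R -> R -> V -> Prop :=
| backtrack_stop mu y :
    is_minimizer_on X (subproblem mu v xi) y ->
    ~~ backtrack_test mu v xi y ->
    backtrack eta v xi mu mu y
| backtrack_step mu y mu' y' :
    is_minimizer_on X (subproblem mu v xi) y ->
    backtrack_test mu v xi y ->
    backtrack eta v xi (eta * mu) mu' y' ->
    backtrack eta v xi mu mu' y'.

Definition mu_init (delta mubar : R) (mu : nat -> R) (k : nat) : R :=
  if k is k'.+1 then Num.max mubar (delta * mu k') else mubar.

(* [mu k] is the value at the end of the k-th backtracking loop; the input t_0
   is [t 0], on which there is no constraint. *)
Record adca_like (eta delta mubar : R) (x w v : nat -> V) (xi : nat -> Z)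
    (mu t : nat -> R) : Prop := {
  adca_x0 : X (x 0%N);
  adca_w0 : w 0%N = x 0%N;
  adca_v : forall k,
    v k = if (phi (w k, gvec (w k)) <= phi (x k, gvec (x k)))%E
          then w k else x k;
  adca_xi : forall k i,
    subdiff *%R (neg_h i) (g (submxrow (v k) i)) (xi k 0 i);
  adca_x : forall k,
    backtrack eta (v k) (xi k) (mu_init delta mubar mu k) (mu k) (x k.+1);
  adca_t : forall k, t k.+1 = (1 + Num.sqrt (1 + 4 * t k ^+ 2)) / 2;
  adca_w : forall k,
    w k.+1 = x k.+1 + ((t k - 1) / t k.+1) *: (x k.+1 - x k) }.

End Problem.

(* Main.v *)
Require Import Defs.
From HB Require Import structures.
From mathcomp Require Import all_boot all_order all_algebra.
From mathcomp Require Import all_classical all_reals all_analysis.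
From mathcomp Require Import ring lra.

Set Implicit Arguments.
Unset Strict Implicit.
Unset Printing Implicit Defensive.

Import Order.TTheory GRing.Theory Num.Theory numFieldNormedType.Exports.

Local Open Scope classical_set_scope.
Local Open Scope ring_scope.

(** Write F(x) for the value of phi at (x, g(x)), that is f(x) + sum_i h_i(g_i(x_i)).

    Decrease. Since the xi_i are nonpositive, the objective of the subproblem is
    mu-strongly convex, hence it exceeds its minimum at x^{k+1} by at least
    mu/2 |u - x^{k+1}|^2 at every u of X ([subproblem_growth]). Taking u = v^k and
    adding the inequality certified by the end of the backtracking loop gives
    F(v^k) - F(x^{k+1}) >= mu_k/2 |x^{k+1} - v^k|^2 ([sufficient_decrease]), and
    F(v^k) <= F(x^k) by the choice of v^k. As mu_k stays above mubar, telescoping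
    makes the squared steps summable when F is bounded below ([steps_summable]).

    Boundedness of mu_k. The descent lemma shows that the loop cannot reject a
    value mu >= L ([backtrack_test_stops]), so that mu_k never exceeds
    max(mubar, eta L) ([mu_le]).

    Limit points. Let x^{k+1} tend to a along an ultrafilter finer than the
    eventuality filter. Then v^k tends to a as well, because the steps vanish; mu_k
    is bounded, and so are the xi_i^k, being subgradients of -h_i near an interior
    point of its domain ([subdiff_neg_h_bounded]). Hence they converge along the
    ultrafilter, and the limits s_i of the xi_i^k are subgradients at g_i(a_i)
    ([subdiff_neg_h_closed]). The growth inequality of the subproblem, whose two
    sides both contain the same multiple of |u - a|^2 in the limit, becomes
    <s, g(u) - g(a)> <= <grad f(a), u - a> for all u in X, and this variational
    inequality makes (mu a - grad f(a), s) a common subgradient of H_mu and G_mu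
    at (a, g(a)) ([critical_of_variational]). *)

(** * Euclidean geometry and the descent lemma *)

Section EuclideanSpace.
Context {R : realType} {k : nat}.
Implicit Types (u v x y d : 'rV[R]_k) (a : R).

Lemma dotC u v : dot u v = dot v u.
Proof. by apply: eq_bigr => j _; rewrite mulrC. Qed.

Lemma dotDl u v w : dot (u + v) w = dot u w + dot v w.
Proof. by rewrite /dot -big_split; apply: eq_bigr => j _; rewrite mxE mulrDl. Qed.

Lemma dotZl a u v : dot (a *: u) v = a * dot u v.
Proof. by rewrite /dot mulr_sumr; apply: eq_bigr => j _; rewrite mxE mulrA. Qed.

Lemma dotNl u v : dot (- u) v = - dot u v.
Proof. by rewrite -scaleN1r dotZl mulN1r. Qed.

Lemma dotBl u v w : dot (u - v) w = dot u w - dot v w.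
Proof. by rewrite dotDl dotNl. Qed.

Lemma dotDr u v w : dot w (u + v) = dot w u + dot w v.
Proof. by rewrite !(dotC w) dotDl. Qed.

Lemma dotZr a u v : dot u (a *: v) = a * dot u v.
Proof. by rewrite !(dotC u) dotZl. Qed.

Lemma dotNr u v : dot v (- u) = - dot v u.
Proof. by rewrite !(dotC v) dotNl. Qed.

Definition dotE := (dotDl, dotDr, dotNl, dotNr, dotZl, dotZr).

Lemma dot_ge0 u : 0 <= dot u u.
Proof. by apply: sumr_ge0 => j _; rewrite -expr2 sqr_ge0. Qed.

Lemma enorm_sqr u : enorm u ^+ 2 = dot u u.
Proof. by rewrite sqr_sqrtr // dot_ge0. Qed.

Lemma enorm_ge0 u : 0 <= enorm u.
Proof. exact: sqrtr_ge0. Qed.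

Lemma coord_le_enorm u j : `|u 0 j| <= enorm u.
Proof.
rewrite -sqrtr_sqr ler_wsqrtr // /dot (bigD1 j) //= -expr2 lerDl.
by apply: sumr_ge0 => i _; rewrite -expr2 sqr_ge0.
Qed.

(** The exact defect of convexity of the squared norm, which is what makes
    [mu / 2 * enorm (y - v) ^+ 2] strongly convex in y. *)
Lemma enorm_conv a u v :
  enorm (a *: u + (1 - a) *: v) ^+ 2 =
  a * enorm u ^+ 2 + (1 - a) * enorm v ^+ 2 - a * (1 - a) * enorm (u - v) ^+ 2.
Proof.
rewrite !enorm_sqr !dotE (dotC v u).
by ring.
Qed.

(** The case of the Cauchy-Schwarz inequality that the descent lemma uses; it
    follows from the nonnegativity of the squared norm of [u - a *: d]. *)
Lemma dot_le_of_enorm_le a u d :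
  0 < a -> enorm u <= a * enorm d -> dot u d <= a * enorm d ^+ 2.
Proof.
move=> a0 ud.
have ud2 : dot u u <= a ^+ 2 * dot d d.
  rewrite -!enorm_sqr -exprMn lerXn2r ?nnegrE ?mulr_ge0 ?enorm_ge0 //.
  exact: ltW.
have := dot_ge0 (u - a *: d).
rewrite !dotE (dotC d u) enorm_sqr => h.
rewrite -(ler_pM2l a0); nra.
Qed.

Lemma derive_grad (f : 'rV[R]_k -> R) x d :
  differentiable f x -> 'D_d f x = dot (grad f x) d.
Proof.
move=> df; rewrite deriveE // [in LHS](row_sum_delta d) linear_sum.
by apply: eq_bigr => j _; rewrite linearZ /= mxE deriveE // mulrC.
Qed.

Lemma is_derive_line (f : 'rV[R]_k -> R) x d (s : R) :
  differentiable f (x + s *: d) ->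
  is_derive s 1 (fun s => f (x + s *: d)) (dot (grad f (x + s *: d)) d).
Proof.
move=> df.
(* The two difference quotients are the same function of h. *)
have quot : (fun h : R => h^-1 *:
      (((fun s => f (x + s *: d)) \o shift s) (h *: (1 : R)) - f (x + s *: d))) =
    (fun h : R => h^-1 *:
      ((f \o shift (x + s *: d)) (h *: d) - f (x + s *: d))).
  apply/funext => h /=; congr (_ *: (f _ - _)).
  by rewrite [h *: 1]mulr1 scalerDl addrCA.
have dfd : derivable f (x + s *: d) d by exact: diff_derivable.
rewrite -derive_grad //; apply: DeriveDef; first by rewrite /derivable quot.
by rewrite /derive quot.
Qed.

(** The function q below subtracts from f, along the segment from x to y, its
    linear part at x and the quadratic majorant; the Lipschitz bound makes its
    derivative nonpositive on ]0, 1[, so the mean value theorem gives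
    [q 1 <= q 0]. *)
Lemma descent_lemma (f : 'rV[R]_k -> R) a x y :
  0 < a -> (forall z, differentiable f z) ->
  (forall z z', enorm (grad f z - grad f z') <= a * enorm (z - z')) ->
  f y <= f x + dot (grad f x) (y - x) + a / 2 * enorm (y - x) ^+ 2.
Proof.
move=> a0 df Lf; set d := y - x.
pose q s := f (x + s *: d)
  - (s * dot (grad f x) d + s ^+ 2 * (a / 2 * enorm d ^+ 2)).
pose q' s := dot (grad f (x + s *: d)) d
  - (dot (grad f x) d + s * (a * enorm d ^+ 2)).
have dq (s : R) : is_derive s 1 q (q' s).
  rewrite /q /q'.
  have dfs := is_derive_line (df (x + s *: d)).
  apply: is_deriveB; apply: is_derive_eq.
  rewrite /GRing.scale /=; by field.
have qc : {within `[0, 1], continuous q}.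
  apply: continuous_subspaceT => s.
  by apply: differentiable_continuous; apply/derivable1_diffP; case: (dq s).
have [s s01 qE] := MVT ltr01 (fun s _ => dq s) qc.
have s0 : 0 < s by move: s01; rewrite in_itv /= => /andP[].
have q's : q' s <= 0.
  rewrite /q' opprD addrA -dotBl mulrA subr_le0.
  have -> : s * a = a * s by rewrite mulrC.
  rewrite -(ler_pM2l s0) mulrA [s * (_ * _)]mulrC -dotZr.
  have -> : a * s * s * enorm d ^+ 2 = a * enorm (s *: d) ^+ 2.
    by rewrite !enorm_sqr dotZl dotZr; ring.
  apply: dot_le_of_enorm_le => //.
  by apply: le_trans (Lf _ _) _; rewrite [x + _]addrC addrK.
have : q 1 <= q 0 by rewrite -subr_le0 qE subr0 mulr1.
rewrite /q !scale1r scale0r addr0 [x + d]addrC subrK.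
by rewrite expr1n expr0n /=; lra.
Qed.

End EuclideanSpace.

(** * Limits along filters *)

Section Limits.
Context {R : realType} {T : Type} {F : set_system T} {FF : Filter F}.

Lemma cvg_row (k : nat) (u : T -> 'rV[R]_k) (l : 'rV[R]_k) :
  (forall j, u s 0 j @[s --> F] --> l 0 j) -> u s @[s --> F] --> l.
Proof.
move=> ul A [B lB BA].
have := filter_forall (f := fun j s => B 0 j (u s 0 j)) FF
  (fun j => ul j _ (lB 0 j)).
by apply: filterS => s Bs; apply: BA => i j; rewrite (ord1 i).
Qed.

Lemma cvg_coord (k : nat) (u : T -> 'rV[R]_k) (l : 'rV[R]_k) j :
  u s @[s --> F] --> l -> u s 0 j @[s --> F] --> l 0 j.
Proof.
by move=> ul; exact: (cvg_comp _ _ ul (@coord_continuous _ _ _ 0 j l)).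
Qed.

Lemma cvg_sum_ord (k : nat) (u : 'I_k -> T -> R) (l : 'I_k -> R) :
  (forall j, u j s @[s --> F] --> l j) ->
  \sum_(j < k) u j s @[s --> F] --> \sum_(j < k) l j.
Proof. by move=> ul; apply: cvg_big => //; exact: add_continuous. Qed.

Lemma cvg_dot (k : nat) (u v : T -> 'rV[R]_k) (a b : 'rV[R]_k) :
  u s @[s --> F] --> a -> v s @[s --> F] --> b ->
  dot (u s) (v s) @[s --> F] --> dot a b.
Proof.
by move=> ua vb; apply: cvg_sum_ord => j; apply: cvgM; exact: cvg_coord.
Qed.

Lemma cvg_enorm_sqr (k : nat) (u : T -> 'rV[R]_k) (a : 'rV[R]_k) :
  u s @[s --> F] --> a -> enorm (u s) ^+ 2 @[s --> F] --> enorm a ^+ 2.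
Proof.
move=> ua; rewrite enorm_sqr.
by under eq_fun do rewrite enorm_sqr; exact: cvg_dot.
Qed.

Lemma cvg_submxrow (q : nat) (n_ : 'I_q -> nat) (u : T -> 'rV[R]_(\sum_i n_ i))
    (a : 'rV[R]_(\sum_i n_ i)) i :
  u s @[s --> F] --> a -> submxrow (u s) i @[s --> F] --> submxrow a i.
Proof.
move=> ua; apply: cvg_row => j; rewrite mxE.
by under eq_fun do rewrite mxE; exact: cvg_coord.
Qed.

Lemma cvg_enorm0 (k : nat) (u : T -> 'rV[R]_k) :
  enorm (u s) @[s --> F] --> (0 : R) -> u s @[s --> F] --> (0 : 'rV[R]_k).
Proof.
move=> u0; apply: cvg_row => j; rewrite mxE.
apply/cvgr0Pnorm_le => e e0; move/cvgr0Pnorm_le : u0 => /(_ e e0).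
apply: filterS => s; apply: le_trans.
by rewrite [leRHS]ger0_norm ?enorm_ge0 ?coord_le_enorm.
Qed.

End Limits.

(** Along an ultrafilter a bounded family has a limit without passing to a
    subsequence, so that finitely many families can be treated one by one. *)
Lemma cvg_ultra_segment {R : realType} {T : Type} (F : set_system T)
    (u : T -> R) (a b : R) :
  UltraFilter F -> (\forall s \near F, a <= u s <= b) ->
  exists l : R, u s @[s --> F] --> l.
Proof.
move=> UF uab.
have Fab : fmap u F `[a, b]%classic.
  by apply: filterS uab => s; rewrite /= in_itv.
have [l [_ lF]] := @segment_compact R a b (fmap u F) _ Fab.
exists l => A lA.
have [//|nA] := in_ultra_setVsetC (u @^-1` A) UF.
by have [s [ns As]] := lF (~` A) A nA lA.
Qed.

Lemma cvg_le_limit {R : realType} {T : Type} (F : set_system T)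
    (FF : ProperFilter F) (u v : T -> R) (a b : R) :
  u s @[s --> F] --> a -> v s @[s --> F] --> b ->
  (\forall s \near F, u s <= v s) -> a <= b.
Proof.
move=> ua vb uv; have vua : v s - u s @[s --> F] --> b - a by exact: cvgB.
rewrite -subr_ge0 -(cvg_lim _ vua) //; apply: limr_ge; first exact: cvgP vua.
by apply: filterS uv => s; rewrite subr_ge0.
Qed.

(** The sets [{k | s k.+1 in B and k in N}], for B a neighbourhood of p and N
    cofinite, form a base of
    a proper filter because p is a cluster point. The shift is there because the iterate k.+1 is
    computed from the data of step k. *)
Lemma cluster_ultra {T : topologicalType} (s : nat -> T) (p : T) :
  cluster (s k @[k --> \oo]) p ->
  exists U : set_system nat,
    [/\ UltraFilter U, \oo `<=` U & s k.+1 @[k --> U] --> p].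
Proof.
move=> clp.
pose F := filter_from [set B : set T * set nat | nbhs p B.1 /\ \oo B.2]
  (fun B => [set k | B.1 (s k.+1) /\ B.2 k]).
have FF : ProperFilter F.
  apply: filter_from_proper; last first.
    move=> [B N] /= [pB [n _ Nn]].
    (* Indices above n.+1 are successors of indices in N. *)
    have [|_ [[k [nk <-]] Bsk]] := clp (s @` [set k | (n < k)%N]) B _ pB.
      by exists n.+1 => // k /= nk; exists k.
    by case: k nk Bsk => // k nk Bsk; exists k; split => //; apply: Nn.
  apply: filter_from_filter; first by exists (setT, setT); split; exact: filterT.
  move=> [B N] [B' N'] /= [pB oN] [pB' oN'].
  exists (B `&` B', N `&` N'); first by split; exact: filterI.
  by move=> k /= [[? ?] [? ?]].
have [U [UU FU]] := ultraFilterLemma FF.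
exists U; split => //.
  move=> N oN; apply: FU; exists (setT, N); last by move=> k [].
  by split => //; exact: filterT.
move=> B pB; apply: FU; exists (B, setT); last by move=> k [].
by split => //; exact: filterT.
Qed.

Lemma bounded_nneg_series_cvg {R : realType} (u : nat -> R) (B : R) :
  (forall k, 0 <= u k) -> (forall n, \sum_(0 <= k < n) u k <= B) ->
  (\sum_(0 <= k <oo) (u k)%:E < +oo)%E /\ u k @[k --> \oo] --> (0 : R).
Proof.
move=> u0 uB; split.
  apply: (@le_lt_trans _ _ B%:E); last exact: ltry.
  apply: lime_le; first by apply: is_cvg_nneseries => k _ _; rewrite lee_fin.
  by apply: nearW => n; rewrite sumEFin lee_fin.
apply: cvg_series_cvg_0; apply: nondecreasing_is_cvgn.
  apply/nondecreasing_seqP => n.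
  by rewrite /series /= big_nat_recr //= lerDl.
by exists B => _ [n _ <-]; exact: uB.
Qed.

(** * Convexity *)

Section ConvexCombinations.
Context {R : realType}.

Lemma convex_set_comb (V : lmodType R) (A : set V) (x y : V) (a : R) :
  convex_set A -> A x -> A y -> 0 <= a -> a <= 1 -> A (a *: x + (1 - a) *: y).
Proof.
move=> cA Ax Ay a0 a1; apply/set_mem.
by apply: (cA x y (Itv01 a0 a1)); exact: mem_set.
Qed.

Lemma convex_function_comb (V : lmodType R) (A : set V) (c : V -> R) (x y : V)
    (a : R) :
  @convex_function R V A c -> A x -> A y -> 0 <= a -> a <= 1 ->
  c (a *: x + (1 - a) *: y) <= a * c x + (1 - a) * c y.
Proof.
by move=> cc Ax Ay a0 a1; exact: (cc (Itv01 a0 a1) _ _ (mem_set Ax) (mem_set Ay)).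
Qed.

(** To the right of s, convexity bounds the slope from below by the slope over the
    segment from a to s; to the left, monotonicity suffices. In particular c is
    lower semicontinuous at s, which lets the subgradient inequalities of -h_i
    pass to the limit. *)
Lemma convex_ge_modulus (A : set R) (c : R -> R) (a s t : R) :
  @convex_function R R^o A c -> {in A &, {homo c : x y /~ x <= y}} ->
  A a -> A s -> A t -> a < s ->
  c s - (c a - c s) / (s - a) * `|t - s| <= c t.
Proof.
move=> cc cd Aa As At als.
have ca : c s <= c a by apply: cd; rewrite ?inE ?ltW.
have [ts|st] := leP t s.
  have : c s <= c t by apply: cd; rewrite ?inE.
  apply: le_trans; rewrite gerBl mulr_ge0 // divr_ge0 ?subr_ge0 //; exact: ltW.
have at0 : 0 < t - a by rewrite subr_gt0 (lt_trans als).
have sa0 : 0 < s - a by rewrite subr_gt0.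
have := @convex_function_comb R^o A c a t ((t - s) / (t - a)) cc Aa At.
rewrite divr_ge0 ?subr_ge0 ?(ltW st) ?(ltW (lt_trans als st)) //.
rewrite ler_pdivrMr // mul1r lerD2l lerN2 (ltW als) => /(_ isT isT).
rewrite ger0_norm ?subr_ge0 ?(ltW st) //.
(* s is the convex combination of a and t with weight (t - s) / (t - a). *)
have -> : (t - s) / (t - a) *: (a : R^o)
    + (1 - (t - s) / (t - a)) *: (t : R^o) = s.
  by rewrite /GRing.scale /=; field; rewrite gt_eqF.
have -> : (t - s) / (t - a) * c a + (1 - (t - s) / (t - a)) * c t =
   ((t - s) * c a + (s - a) * c t) / (t - a) by field; rewrite gt_eqF.
rewrite ler_pdivlMr // => h.
rewrite -(ler_pM2l sa0).
have -> : (s - a) * (c s - (c a - c s) / (s - a) * (t - s)) =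
   (s - a) * c s - (c a - c s) * (t - s) by field; rewrite gt_eqF.
by lra.
Qed.

End ConvexCombinations.

Section Problem.
Context {R : realType} {m : nat} {n_ : 'I_m -> nat} {P : problem R n_} {L : R}.
Context (SA : standing_assumptions P L).

Local Notation V := 'rV[R]_(\sum_i n_ i).
Local Notation X := (X_ P).
Local Notation f := (f_ P).
Local Notation g := (g_ P).
Local Notation D := (D_ P).
Local Notation h := (h_ P).

(** * Values of phi and H on the graph of g *)

Lemma gvecE x i : gvec P x 0 i = g (submxrow x i).
Proof. by rewrite mxE. Qed.

Definition objective (x : V) : R := f x + \sum_(i < m) h i (g (submxrow x i)).

Lemma phi_graph x :
  phi P (x, gvec P x) = if x \in X then (objective x)%:E else +oo%E.
Proof.
rewrite /phi /chi_Omega /=.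
have -> : ((x, gvec P x) \in Omega P) = (x \in X).
  apply/idP/idP => /set_mem; first by case=> Xx _; exact: mem_set.
  by move=> Xx; apply: mem_set; split => // i; rewrite mxE.
case: ifP => _; last by rewrite addye.
rewrite add0e /objective; congr (_ + _)%:E.
by apply: eq_bigr => i _; rewrite mxE.
Qed.

Lemma sum_neg_h (z : 'rV[R]_m) : (forall i, D i (z 0 i)) ->
  (\sum_(i < m) neg_h P i (z 0%R i))%E = (- \sum_(i < m) h i (z 0 i))%:E.
Proof.
move=> Dz; rewrite -sumrN -sumEFin; apply: eq_bigr => i _.
by rewrite /neg_h mem_set.
Qed.

Lemma H_graph mu x : X x ->
  H P mu (x, gvec P x) = (mu / 2 * enorm x ^+ 2 - objective x)%:E.
Proof.
move=> Xx; rewrite /H sum_neg_h /=; last first.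
  by move=> i; rewrite mxE; exact: D_contains SA _ _ Xx.
rewrite -EFinD; congr (_%:E); rewrite /objective opprD addrA; congr (_ - _).
by apply: eq_bigr => i _; rewrite mxE.
Qed.

Lemma backtrack_testE mu v xi y : X v -> X y ->
  backtrack_test P mu v xi y =
  (mu / 2 * enorm y ^+ 2 - objective y <
   mu / 2 * enorm v ^+ 2 - objective v
   + (dot (mu *: v - grad f v) (y - v) + dot xi (gvec P y - gvec P v))).
Proof. by move=> Xv Xy; rewrite /backtrack_test !H_graph // -EFinD lte_fin. Qed.

Lemma subdiff_neg_hP i t s : D i t ->
  subdiff *%R (neg_h P i) t s <->
  (forall q, D i q -> h i q <= h i t - s * (q - t)).
Proof.
move=> Dt; rewrite /subdiff /= /neg_h (mem_set Dt); split.
  by move=> [_ ht] q Dq; move: (ht q); rewrite (mem_set Dq) -EFinD lee_fin; lra.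
move=> ht; split => // q; case: ifPn => [/set_mem Dq|_]; last exact: leey.
by rewrite -EFinD lee_fin; have := ht q Dq; lra.
Qed.

Lemma subdiff_neg_h_le0_at i v s :
  X v -> subdiff *%R (neg_h P i) (g (submxrow v i)) s -> s <= 0.
Proof. by move=> Xv; apply: (subdiff_neg_h_le0 SA); exists v. Qed.

(** * The subproblem and the backtracking loop *)

Lemma subproblemE mu v xi y : subproblem P mu v xi y =
  mu / 2 * enorm (y - v) ^+ 2 + dot (grad f v) y - dot xi (gvec P y).
Proof.
rewrite /subproblem /dot -sumrN; congr (_ + _).
by apply: eq_bigr => i _; rewrite gvecE mulNr.
Qed.

(** Nonpositivity of xi turns the convexity of the g_i into concavity of
    [dot xi (gvec P y)] in y. *)
Lemma subproblem_conv mu v (xi : 'rV[R]_m) y u a :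
  (forall i, xi 0 i <= 0) -> 0 <= a -> a <= 1 ->
  subproblem P mu v xi (a *: u + (1 - a) *: y) <=
  a * subproblem P mu v xi u + (1 - a) * subproblem P mu v xi y
  - mu / 2 * (a * (1 - a) * enorm (u - y) ^+ 2).
Proof.
move=> xi0 a0 a1; rewrite !subproblemE.
have -> : a *: u + (1 - a) *: y - v = a *: (u - v) + (1 - a) *: (y - v).
  by rewrite !scalerBr addrACA -opprD -scalerDl addrCA subrr addr0 scale1r.
have uy : u - v - (y - v) = u - y by rewrite opprB addrA subrK.
rewrite enorm_conv uy !dotDr !dotZr.
have gc : a * dot xi (gvec P u) + (1 - a) * dot xi (gvec P y) <=
    dot xi (gvec P (a *: u + (1 - a) *: y)).
  rewrite -!dotZr -dotDr; apply: ler_sum => i _.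
  rewrite ler_wnM2l // !mxE submxrowD.
  have -> : submxrow (a *: u) i = a *: submxrow u i.
    by apply/matrixP => ? ?; rewrite !mxE.
  have -> : submxrow ((1 - a) *: y) i = (1 - a) *: submxrow y i.
    by apply/matrixP => ? ?; rewrite !mxE.
  exact: (convex_function_comb (g_convex SA (i := i)) I I a0 a1).
by lra.
Qed.

(** Compare the minimizer y with the points [a *: u + (1 - a) *: y] and divide
    by a: what remains differs from the claim by a multiple of a, which can be
    taken small. *)
Lemma subproblem_growth mu v (xi : 'rV[R]_m) y u :
  0 <= mu -> (forall i, xi 0 i <= 0) ->
  is_minimizer_on X (subproblem P mu v xi) y -> X u ->
  subproblem P mu v xi y + mu / 2 * enorm (u - y) ^+ 2 <= subproblem P mu v xi u.
Proof.
move=> mu0 xi0 [Xy ymin] Xu; set c := _ * _ ^+ 2.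
have c0 : 0 <= c by rewrite mulr_ge0 ?divr_ge0 ?sqr_ge0.
set Qy := subproblem _ _ _ _ y; set Qu := subproblem _ _ _ _ u.
rewrite leNgt; apply/negP => gap.
(* With e the violation of the claim, the comparison gives e <= a * c; for the
   weight a = e / (c + e) this reads e ^+ 2 <= 0. *)
pose e := Qy + c - Qu; have e0 : 0 < e by rewrite subr_gt0.
have ce0 : 0 < c + e by rewrite ltr_wpDl.
pose a := e / (c + e).
have a0 : 0 < a by rewrite divr_gt0.
have a1 : a <= 1 by rewrite ler_pdivrMr // mul1r lerDr.
have := subproblem_conv mu v y u xi0 (ltW a0) a1.
have := ymin _ (convex_set_comb (X_convex SA) Xu Xy (ltW a0) a1).
rewrite -/Qy -/Qu => Qle /(le_trans Qle).
have -> : mu / 2 * (a * (1 - a) * enorm (u - y) ^+ 2) = a * (1 - a) * c.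
  by rewrite /c; ring.
move=> bound.
have : a * (e - a * c) <= 0 by rewrite /e; lra.
rewrite pmulr_rle0 // subr_le0 /a mulrAC ler_pdivlMr // => ineq.
by have := mulr_gt0 e0 e0; lra.
Qed.

(** The growth of the subproblem provides mu times the squared step, and the
    failed test costs half of it. *)
Lemma sufficient_decrease mu v (xi : 'rV[R]_m) y :
  0 <= mu -> X v ->
  (forall i, subdiff *%R (neg_h P i) (g (submxrow v i)) (xi 0 i)) ->
  is_minimizer_on X (subproblem P mu v xi) y -> ~~ backtrack_test P mu v xi y ->
  mu / 2 * enorm (y - v) ^+ 2 <= objective v - objective y.
Proof.
move=> mu0 Xv xiv ymin.
have xi0 i : xi 0 i <= 0 by exact: subdiff_neg_h_le0_at (xiv i).
have := subproblem_growth mu0 xi0 ymin Xv.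
rewrite backtrack_testE //; last by case: ymin.
rewrite -leNgt !subproblemE !enorm_sqr !dotE (dotC y v); lra.
Qed.

(** The test compares [H P mu] with an affine function at v. For mu >= L, the
    descent lemma handles the part of H in x, and the subgradient inequalities
    of the -h_i handle the rest. *)
Lemma backtrack_test_stops mu v (xi : 'rV[R]_m) y :
  0 < mu -> L <= mu -> X v -> X y ->
  (forall i, subdiff *%R (neg_h P i) (g (submxrow v i)) (xi 0 i)) ->
  ~~ backtrack_test P mu v xi y.
Proof.
move=> mu0 Lmu Xv Xy xiv; rewrite backtrack_testE // -leNgt.
have := descent_lemma v y mu0 (f_differentiable SA) _.
have Lip z z' : enorm (grad f z - grad f z') <= mu * enorm (z - z').
  by apply: le_trans (grad_lipschitz SA z z') _; rewrite ler_wpM2r ?enorm_ge0.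
move=> /(_ Lip).
have hle : \sum_(i < m) h i (g (submxrow y i)) <=
    \sum_(i < m) h i (g (submxrow v i)) - dot xi (gvec P y - gvec P v).
  rewrite /dot -sumrB; apply: ler_sum => i _; rewrite !mxE.
  by apply (subdiff_neg_hP _ (D_contains SA i Xv)).1 => //; exact: D_contains SA _ _ Xy.
move: hle; rewrite /objective !enorm_sqr !dotE (dotC y v); lra.
Qed.

(** Only values below L are ever multiplied by eta, whence the upper bound. *)
Lemma backtrackP eta v (xi : 'rV[R]_m) mu mu' y :
  backtrack P eta v xi mu mu' y -> 1 < eta -> 0 < mu -> X v ->
  (forall i, subdiff *%R (neg_h P i) (g (submxrow v i)) (xi 0 i)) ->
  [/\ is_minimizer_on X (subproblem P mu' v xi) y,
      ~~ backtrack_test P mu' v xi y, mu <= mu' & mu' <= Num.max mu (eta * L)].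
Proof.
move=> + eta1 + Xv xiv; elim=> [{}mu {}y ymin stop mu0|{}mu {}y {}mu' y'].
  by split => //; rewrite le_max lexx.
move=> ymin test _ IH mu0.
have muL : mu < L.
  rewrite ltNge; apply/negP => Lmu; case: ymin => Xy _.
  by move: test; apply/negP; exact: backtrack_test_stops.
have eta0 : 0 < eta by exact: lt_trans ltr01 eta1.
have [y'min stop mumu' mu'le] := IH (mulr_gt0 eta0 mu0).
split => //; first by apply: le_trans mumu'; rewrite ler_peMl ?ltW.
apply: le_trans mu'le _; rewrite ge_max !le_max lexx orbT andbT.
by apply/orP; right; rewrite ler_pM2l // ltW.
Qed.

(** * Limits of g and of subgradients of -h_i *)

Lemma cvg_gvec {T : Type} (F : set_system T) {FF : Filter F}
    (y : T -> 'rV[R]_(\sum_i n_ i)) a :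
  y k @[k --> F] --> a -> gvec P (y k) @[k --> F] --> gvec P a.
Proof.
move=> ya; apply: cvg_row => i; rewrite gvecE.
under eq_fun do rewrite gvecE.
exact: (cvg_comp _ _ (cvg_submxrow (i := i) ya)
  (g_continuous SA (x := submxrow a i))).
Qed.

Lemma subdiff_neg_h_dom i t s : subdiff *%R (neg_h P i) t s -> D i t.
Proof. by case; rewrite /neg_h; case: ifPn => // /set_mem. Qed.

(** The subgradient inequality tested at a point a of the domain to the left of
    t0 bounds [- s k] by the slope of h_i between a and [t k]; monotonicity bounds
    [h i (t k)] by the value at a point b to the right of t0. *)
Lemma subdiff_neg_h_bounded {T : Type} (F : set_system T) {FF : Filter F}
    i (t s : T -> R) (t0 : R) :
  t k @[k --> F] --> t0 -> D i t0 ->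
  (forall k, subdiff *%R (neg_h P i) (t k) (s k)) -> (forall k, s k <= 0) ->
  exists M, \forall k \near F, - M <= s k <= 0.
Proof.
move=> tt0 Dt0 ts s0.
have /nbhs_ballP[e /= e0 De] : nbhs t0 (D i).
  by apply: open_nbhs_nbhs; split => //; exact: D_open SA i.
pose a := t0 - e / 2; pose b := t0 + e / 2.
have Da : D i a.
  by apply: De; rewrite /ball /= /a ltr_norml; apply/andP; split; lra.
have Db : D i b.
  by apply: De; rewrite /ball /= /b ltr_norml; apply/andP; split; lra.
exists (4 * (h i b - h i a) / e).
have e4 : 0 < e / 4 by lra.
move/cvgrPdist_le : tt0 => /(_ _ e4); apply: filterS => k.
rewrite ler_norml => /andP[tk1 tk2]; rewrite s0 andbT.
have Dt := subdiff_neg_h_dom (ts k).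
have ha := (subdiff_neg_hP (s k) Dt).1 (ts k) a Da.
have hb : h i (t k) <= h i b.
  by apply: (h_nondecreasing SA); rewrite ?inE // /b; lra.
rewrite lerNl ler_pdivlMr //.
have : 0 <= - s k by rewrite oppr_ge0.
move: ha; rewrite /a; nra.
Qed.

(** Only the upper bound [h i t0 + K * `|t k - t0|] for [h i (t k)] is passed to
    the limit; it comes from [convex_ge_modulus]. *)
Lemma subdiff_neg_h_closed {T : Type} (F : set_system T) {FF : ProperFilter F}
    i (t s : T -> R) (t0 s0 : R) :
  t k @[k --> F] --> t0 -> s k @[k --> F] --> s0 -> D i t0 ->
  (forall k, subdiff *%R (neg_h P i) (t k) (s k)) ->
  subdiff *%R (neg_h P i) t0 s0.
Proof.
move=> tt0 ss0 Dt0 ts; apply/subdiff_neg_hP => // q Dq.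
have /nbhs_ballP[e /= e0 De] : nbhs t0 (D i).
  by apply: open_nbhs_nbhs; split => //; exact: D_open SA i.
pose a := t0 - e / 2.
have Da : D i a.
  by apply: De; rewrite /ball /= /a ltr_norml; apply/andP; split; lra.
have at0 : a < t0 by rewrite /a; lra.
pose K := (- h i a - - h i t0) / (t0 - a).
have dt0 : `|t k - t0| @[k --> F] --> (0 : R).
  rewrite -(normr0 R) -(subrr t0); apply: cvg_norm.
  by apply: cvgB => //; exact: cvg_cst.
have rhs : h i t0 + K * `|t k - t0| - s k * (q - t k) @[k --> F] -->
    h i t0 + K * 0 - s0 * (q - t0).
  apply: cvgB.
    by apply: cvgD; [exact: cvg_cst | apply: cvgM => //; exact: cvg_cst].
  by apply: cvgM => //; apply: cvgB => //; exact: cvg_cst.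
have -> : h i t0 - s0 * (q - t0) = h i t0 + K * 0 - s0 * (q - t0).
  by rewrite mulr0 addr0.
apply: (cvg_le_limit _ (cvg_cst (h i q)) rhs); apply: nearW => k.
have Dt := subdiff_neg_h_dom (ts k).
have hq := (subdiff_neg_hP (s k) Dt).1 (ts k) q Dq.
have := convex_ge_modulus (h_concave SA (i := i)) _ Da Dt0 Dt at0.
rewrite -/K => usc; apply: le_trans hq _; rewrite lerD2r.
suff : - h i t0 - K * `|t k - t0| <= - h i (t k) by lra.
by apply: usc => u u' Du Du' uu'; rewrite lerN2; exact: (h_nondecreasing SA).
Qed.

(** * Criticality *)

(** The witness is [(mu *: x - grad f x, xi)]. It is a subgradient of H by the
    descent lemma with constant mu >= L. For G, xi <= 0 reduces the inequality at
    (u, z) with g(u) <= z to the one at z = g(u), which is the variational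
    inequality plus [mu / 2 * enorm (u - x) ^+ 2]. *)
Lemma critical_of_variational (x : V) (xi : 'rV[R]_m) :
  X x -> (forall i, subdiff *%R (neg_h P i) (g (submxrow x i)) (xi 0 i)) ->
  (forall u, X u -> dot xi (gvec P u - gvec P x) <= dot (grad f x) (u - x)) ->
  is_critical P L (x, gvec P x).
Proof.
move=> Xx xix var mu mu0 Lmu; exists (mu *: x - grad f x, xi); split; split.
- by rewrite H_graph.
- move=> [u z]; rewrite /H /=.
  have Lip y y' : enorm (grad f y - grad f y') <= mu * enorm (y - y').
    by apply: le_trans (grad_lipschitz SA y y') _; rewrite ler_wpM2r ?enorm_ge0.
  have smooth := descent_lemma x u mu0 (f_differentiable SA) Lip.
  have hz : (\sum_(i < m) neg_h P i (gvec P x 0%R i) + (dot xi (z - gvec P x))%:E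
      <= \sum_(i < m) neg_h P i (z 0%R i))%E.
    rewrite /dot -sumEFin -big_split; apply: lee_sum => i _ /=.
    by have := (xix i).2 (z 0 i); rewrite !mxE.
  apply: le_trans (leeD (lexx _) hz).
  rewrite sum_neg_h; last by move=> i; rewrite mxE; exact: D_contains SA _ _ Xx.
  rewrite -!EFinD lee_fin /dot2 /=.
  by move: smooth; rewrite !enorm_sqr !dotE (dotC u x); lra.
- rewrite /G /chi_Omega mem_set //=; split => // i; by rewrite mxE.
- have Ox : Omega P (x, gvec P x) by split => // i; rewrite mxE.
  move=> [u z]; rewrite /G /chi_Omega (mem_set Ox) /= adde0.
  case: ifPn => [/set_mem [/= Xu gz]|_]; last by rewrite addey ?leey.
  rewrite adde0 -EFinD lee_fin /dot2 /=.
  have xiz : dot xi (z - gvec P x) <= dot xi (gvec P u - gvec P x).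
    apply: ler_sum => i _; rewrite !mxE ler_wnM2l ?lerB ?gz //.
    exact: (subdiff_neg_h_le0_at Xx (xix i)).
  have := dot_ge0 (u - x); have := mulr_ge0 (ltW mu0) (dot_ge0 (u - x)).
  have := var u Xu; move: xiz.
  by rewrite !enorm_sqr !dotE (dotC u x); lra.
Qed.

End Problem.

(** * The algorithm *)

Section Algorithm.
Context {R : realType} {m : nat} {n_ : 'I_m -> nat} {P : problem R n_} {L : R}.
Context {eta delta mubar : R}.
Context {x w v : nat -> 'rV[R]_(\sum_i n_ i)} {xi : nat -> 'rV[R]_m}.
Context {mu t : nat -> R}.
Context (SA : standing_assumptions P L).
Context (eta1 : 1 < eta) (delta01 : 0 < delta < 1) (mubar0 : 0 < mubar).
Context (ALG : adca_like P eta delta mubar x w v xi mu t).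

Local Notation X := (X_ P).
Local Notation f := (f_ P).
Local Notation g := (g_ P).
Local Notation obj := (objective (P := P)).

Lemma mu_init_ge k : mubar <= mu_init delta mubar mu k.
Proof. by case: k => [|k] /=; rewrite ?le_max lexx. Qed.

Lemma mu_init_gt0 k : 0 < mu_init delta mubar mu k.
Proof. exact: lt_le_trans mubar0 (mu_init_ge k). Qed.

(** The extrapolated point w may leave X, but phi is infinite there, so that it is
    then rejected as v. *)
Lemma v_in_X k : X (x k) -> X (v k) /\ obj (v k) <= obj (x k).
Proof.
move=> Xx; rewrite (adca_v ALG) !phi_graph (mem_set Xx).
by case: ifPn => //; case: ifPn => // /set_mem Xw; rewrite lee_fin.
Qed.

Lemma x_in_X k : X (x k).
Proof.
elim: k => [|k Xx]; first exact: adca_x0 ALG.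
have [Xv _] := v_in_X Xx.
by have [[]] := backtrackP SA (adca_x ALG k) eta1 (mu_init_gt0 k) Xv (adca_xi ALG k).
Qed.

Lemma v_X k : X (v k).
Proof. by have [] := v_in_X (x_in_X k). Qed.

Lemma stepP k :
  [/\ is_minimizer_on X (subproblem P (mu k) (v k) (xi k)) (x k.+1),
      ~~ backtrack_test P (mu k) (v k) (xi k) (x k.+1),
      mu_init delta mubar mu k <= mu k &
      mu k <= Num.max (mu_init delta mubar mu k) (eta * L)].
Proof.
exact (backtrackP SA (adca_x ALG k) eta1 (mu_init_gt0 k) (v_X k) (adca_xi ALG k)).
Qed.

Lemma mu_ge k : mubar <= mu k.
Proof. by have [_ _ mk _] := stepP k; exact: le_trans (mu_init_ge k) mk. Qed.

Lemma mu_gt0 k : 0 < mu k.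
Proof. exact: lt_le_trans mubar0 (mu_ge k). Qed.

(** The bound is an invariant: the restart value is at most the larger of mubar
    and the previous mu, and the loop does not push mu above eta * L. *)
Lemma mu_le k : mu k <= Num.max mubar (eta * L).
Proof.
suff init_le : mu_init delta mubar mu k <= Num.max mubar (eta * L).
  have [_ _ _ mk] := stepP k; apply: le_trans mk _.
  by rewrite ge_max init_le le_max lexx orbT.
elim: k => [|k IH] /=; first by rewrite le_max lexx.
rewrite ge_max le_max lexx /=.
have [_ _ _ mk] := stepP k.
apply: (@le_trans _ _ (mu k)).
  by rewrite ler_piMl ?(ltW (mu_gt0 k)) //; case/andP: delta01 => _ /ltW.
by apply: le_trans mk _; rewrite ge_max IH le_max lexx orbT.
Qed.

Lemma objective_decrease k :
  mu k / 2 * enorm (x k.+1 - v k) ^+ 2 <= obj (x k) - obj (x k.+1).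
Proof.
have [ymin stop _ _] := stepP k.
have dec := sufficient_decrease SA (ltW (mu_gt0 k)) (v_X k) (adca_xi ALG k) ymin stop.
apply: le_trans dec _.
by rewrite lerD2r; have [] := v_in_X (x_in_X k).
Qed.

Lemma phi_iterate k : phi P (x k, gvec P (x k)) = (obj (x k))%:E.
Proof. by rewrite phi_graph (mem_set (x_in_X k)). Qed.

Lemma objective_bounded : (-oo < ereal_inf (range (phi P)))%E ->
  exists A, forall k, A <= obj (x k).
Proof.
have inf_le k : (ereal_inf (range (phi P)) <= (obj (x k))%:E)%E.
  by rewrite -phi_iterate; apply: ereal_inf_lbound; exists (x k, gvec P (x k)).
case: ereal_inf inf_le => [A inf_le _|inf_le _|//].
  by exists A => k; rewrite -lee_fin.
by have := inf_le 0%N; rewrite leye_eq.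
Qed.

Lemma steps_summable : (-oo < ereal_inf (range (phi P)))%E ->
  (\sum_(0 <= k <oo) (enorm (x k.+1 - v k) ^+ 2)%:E < +oo)%E /\
  enorm (x k.+1 - v k) @[k --> \oo] --> (0 : R).
Proof.
move=> /objective_bounded[A objA].
have telescope n : mubar / 2 * \sum_(0 <= k < n) enorm (x k.+1 - v k) ^+ 2 <=
    obj (x 0%N) - obj (x n).
  elim: n => [|n IH]; first by rewrite big_geq // mulr0 subrr.
  rewrite big_nat_recr //= mulrDr.
  have := objective_decrease n.
  have : mubar / 2 * enorm (x n.+1 - v n) ^+ 2 <=
      mu n / 2 * enorm (x n.+1 - v n) ^+ 2.
    by rewrite ler_wpM2r ?sqr_ge0 // ler_pM2r ?mu_ge.
  lra.
have bounded n : \sum_(0 <= k < n) enorm (x k.+1 - v k) ^+ 2 <=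
    (obj (x 0%N) - A) / (mubar / 2).
  rewrite ler_pdivlMr ?divr_gt0 // mulrC; apply: le_trans (telescope n) _.
  by rewrite lerD2l lerN2.
have [sum_lt sqr0] := bounded_nneg_series_cvg (fun k => sqr_ge0 _) bounded.
split => //.
have -> : (fun k => enorm (x k.+1 - v k)) =
    (fun k => Num.sqrt (enorm (x k.+1 - v k) ^+ 2)).
  by apply/funext => k; rewrite sqrtr_sqr ger0_norm ?enorm_ge0.
rewrite -(@sqrtr0 R).
exact: (cvg_comp _ _ sqr0 (@sqrt_continuous R 0)).
Qed.

(** Every quantity in the growth inequality of the subproblem converges along the
    ultrafilter U; the limit is the variational inequality at p.1. *)
Lemma limit_points_critical p : (-oo < ereal_inf (range (phi P)))%E ->
  cluster ((x k, gvec P (x k)) @[k --> \oo]) p -> is_critical P L p.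
Proof.
move=> /steps_summable[_ step0] /cluster_ultra[U [UU ooU xgp]].
have PU : ProperFilter U by exact: ultra_proper.
have xp : x k.+1 @[k --> U] --> p.1 by exact: (cvg_comp _ _ xgp cvg_fst).
have gp : gvec P (x k.+1) @[k --> U] --> p.2 by exact: (cvg_comp _ _ xgp cvg_snd).
have gxp : gvec P (x k.+1) @[k --> U] --> gvec P p.1 by exact: (cvg_gvec SA).
(* By continuity of g, limit points of the graph stay on the graph. *)
have pE : p = (p.1, gvec P p.1).
  rewrite [LHS]surjective_pairing; congr (_, _); apply/rowP => i.
  have gpi : gvec P (x k.+1) 0 i @[k --> U] --> p.2 0 i by exact: (cvg_coord gp).
  have gxpi : gvec P (x k.+1) 0 i @[k --> U] --> gvec P p.1 0 i.
    exact: (cvg_coord gxp).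
  by rewrite -(cvg_lim _ gpi) // (cvg_lim _ gxpi).
have vp : v k @[k --> U] --> p.1.
  have dU : enorm (x k.+1 - v k) @[k --> U] --> (0 : R).
    by move=> B /step0 B0; exact: ooU.
  rewrite -[p.1]subr0.
  have -> : v = (fun k => x k.+1 - (x k.+1 - v k)).
    by apply/funext => k; rewrite subKr.
  by apply: cvgB => //; exact: cvg_enorm0.
have Xp : X p.1.
  by apply: (closed_cvg _ (X_closed SA) _ _ xp); apply: nearW => k; exact: x_in_X.
have gvp i : g (submxrow (v k) i) @[k --> U] --> g (submxrow p.1 i).
  have gv : gvec P (v k) 0 i @[k --> U] --> gvec P p.1 0 i.
    exact: (cvg_coord (cvg_gvec SA vp)).
  by move: gv; rewrite gvecE; under eq_fun do rewrite gvecE.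
have xi0 k i : xi k 0 i <= 0.
  exact (subdiff_neg_h_le0_at SA (v_X k) (adca_xi ALG k i)).
have /(_ _)/cid xi_lim i : exists l, xi k 0 i @[k --> U] --> (l : R).
  have [M xiM] := subdiff_neg_h_bounded SA (gvp i) (D_contains SA i Xp)
    (fun k => adca_xi ALG k i) (fun k => xi0 k i).
  exact: cvg_ultra_segment xiM.
pose xis : 'rV[R]_m := \row_i projT1 (xi_lim i).
have xip : xi k @[k --> U] --> xis.
  by apply: cvg_row => i; rewrite mxE; exact: projT2 (xi_lim i).
have [mus mup] : exists l : R, mu k @[k --> U] --> l.
  apply: (@cvg_ultra_segment _ _ _ _ mubar (Num.max mubar (eta * L)) UU).
  by apply: nearW => k; rewrite mu_ge mu_le.
have gradp : grad f (v k) @[k --> U] --> grad f p.1.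
  exact: (cvg_comp _ _ vp (grad_continuous SA (x := p.1))).
have subp (y : nat -> 'rV[R]_(\sum_i n_ i)) a : y k @[k --> U] --> a ->
    subproblem P (mu k) (v k) (xi k) (y k) @[k --> U] -->
    subproblem P mus p.1 xis a.
  move=> ya; rewrite subproblemE; under eq_fun do rewrite subproblemE.
  apply: cvgB; last by apply: cvg_dot => //; exact: (cvg_gvec SA).
  apply: cvgD; last exact: cvg_dot.
  apply: cvgM; first by apply: cvgM => //; exact: cvg_cst.
  by apply: cvg_enorm_sqr; exact: cvgB.
rewrite pE; apply: (critical_of_variational SA (xi := xis)) => // [i|u Xu].
  apply: (subdiff_neg_h_closed SA (gvp i) (cvg_coord (j := i) xip)) => [|k].
    exact: D_contains SA _ _ Xp.
  exact: adca_xi ALG k i.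
have lhs : subproblem P (mu k) (v k) (xi k) (x k.+1)
    + mu k / 2 * enorm (u - x k.+1) ^+ 2 @[k --> U] -->
    subproblem P mus p.1 xis p.1 + mus / 2 * enorm (u - p.1) ^+ 2.
  apply: cvgD; first exact: (subp (fun k => x k.+1)).
  apply: cvgM; first by apply: cvgM => //; exact: cvg_cst.
  by apply: cvg_enorm_sqr; apply: cvgB => //; exact: cvg_cst.
have growth : \forall k \near U, subproblem P (mu k) (v k) (xi k) (x k.+1)
    + mu k / 2 * enorm (u - x k.+1) ^+ 2 <= subproblem P (mu k) (v k) (xi k) u.
  apply: nearW => k; have [ymin _ _ _] := stepP k.
  exact (subproblem_growth SA (ltW (mu_gt0 k)) (xi0 k) ymin Xu).
have rhs : subproblem P (mu k) (v k) (xi k) u @[k --> U] -->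
    subproblem P mus p.1 xis u.
  by apply: (subp (fun=> u)); exact: cvg_cst.
have := cvg_le_limit PU lhs rhs growth.
by rewrite !subproblemE !enorm_sqr !dotE; lra.
Qed.

End Algorithm.

Theorem theorem3 (R : realType) (m : nat) (n_ : 'I_m -> nat)
    (P : problem R n_) (L : R) (eta delta mubar : R)
    (x w v : nat -> 'rV[R]_(\sum_i n_ i)) (xi : nat -> 'rV[R]_m)
    (mu t : nat -> R) :
  standing_assumptions P L ->
  1 < eta -> 0 < delta < 1 -> 0 < mubar ->
  adca_like P eta delta mubar x w v xi mu t ->
  [/\ (* (i) *)
      nonincreasing_seq (fun k => phi P (x k, gvec P (x k))) /\
      (forall k,
        ((mu k / 2 * enorm (x k.+1 - v k) ^+ 2)%:E <=
         phi P (x k, gvec P (x k)) - phi P (x k.+1, gvec P (x k.+1)))%E),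
      (* (ii) *)
      (-oo < ereal_inf (range (phi P)))%E ->
        (\sum_(0 <= k <oo) (enorm (x k.+1 - v k) ^+ 2)%:E < +oo)%E /\
        enorm (x k.+1 - v k) @[k --> \oo] --> (0 : R)
    & (* (iii) *)
      (-oo < ereal_inf (range (phi P)))%E ->
        forall p, cluster ((x k, gvec P (x k)) @[k --> \oo]) p ->
          is_critical P L p].
Proof.
move=> SA eta1 delta01 mubar0 ALG.
have phiE := phi_iterate SA eta1 mubar0 ALG.
have dec := objective_decrease SA eta1 mubar0 ALG.
split.
- split; last by move=> k; rewrite !phiE -EFinB lee_fin.
  apply/nonincreasing_seqP => k; rewrite !phiE lee_fin -subr_ge0.
  apply: le_trans (dec k); rewrite mulr_ge0 ?sqr_ge0 // divr_ge0 //.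
  exact: ltW (mu_gt0 SA eta1 mubar0 ALG k).
- exact: steps_summable SA eta1 mubar0 ALG.
- by move=> inf p; exact (limit_points_critical SA eta1 delta01 mubar0 ALG inf).
Qed.
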